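(* The rectangle $(0,9]\times[0,2)$ of parameters $(\beta,\alpha)$ is divided into the following three regions, according to the stability of the Lagrangian circular relative equilibrium determined by $\alpha$ and $\beta$: 1. region of linear stability: $\mathit{LS}=\left\{(\beta,\alpha)\in(0,9]\times[0,2):\ \beta<9\left(\frac{\alpha-2}{\alpha+2}\right)^2\right\}$, where the relative equilibrium is linearly stable; 2. curve of spectral (but not linear) stability: $\mathit{SS}=\left\{(\beta,\alpha)\in(0,9]\times[0,2):\ \beta=9\left(\frac{\alpha-2}{\alpha+2}\right)^2\right\}$, where it is spectrally stable but not linearly stable; 3. region of spectral instability: $\mathit{SI}=\left\{(\beta,\alpha)\in(0,9]\times[0,2):\ \beta>9\left(\frac{\alpha-2}{\alpha+2}\right)^2\right\}$, where it is not spectrally stable.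
   Context: The Lagrangian circular relative equilibrium is the rigidly rotating equilateral-triangle solution of the planar three-body problem with masses $m_1,m_2,m_3>0$ and potential $\sum_{i<j}m_im_j|q_i-q_j|^{-\alpha}$ ($\alpha\in(0,2)$) or $-\sum_{i<j}m_im_j\log|q_i-q_j|$ ($\alpha=0$); $\beta=27(m_1m_2+m_1m_3+m_2m_3)/(m_1+m_2+m_3)^2\in(0,9]$. After fixing the centre of mass, passing to a uniformly rotating frame and rescaling time, the linearised Hamiltonian system on the reduced 8-dimensional phase space is autonomous and splits into two 4-dimensional invariant symplectic subsystems, on subspaces $E_2$ and $E_3$. The one on $E_2$ is always degenerate (it has the double eigenvalue $0$ coming from the symmetries and first integrals); the one on $E_3$ is $\xi'=\Lambda_3\xi$ with $$\Lambda_3=\begin{pmatrix}0&1&\frac12\left(\alpha+\frac{\alpha+2}{3}\sqrt{9-\beta}\right)&0\\ -1&0&0&\frac12\left(\alpha-\frac{\alpha+2}{3}\sqrt{9-\beta}\right)\\ 1&0&0&1\\ 0&1&-1&0\end{pmatrix}.$$ By definition, the relative equilibrium is spectrally stable if the four eigenvalues of $\Lambda_3$ are purely imaginary, and linearly stable if in addition $\Lambda_3$ is diagonalisable (over $\mathbb{C}$). *)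

(* Defs.v *)
From HB Require Import structures.
From mathcomp Require Import all_boot all_order all_algebra.
From mathcomp Require Import complex.
From mathcomp Require Import classical_sets set_interval reals.

Set Implicit Arguments.
Unset Strict Implicit.
Unset Printing Implicit Defensive.

Import Order.TTheory GRing.Theory Num.Theory.
Local Open Scope ring_scope.
Local Open Scope classical_set_scope.

Section LagrangeEquilibrium.
Variable R : realType.
Implicit Types beta alpha : R.

(* The linearisation xi' = Lambda3 xi on the nontrivial invariant symplectic
   subspace E_3, for a Lagrangian circular relative equilibrium with
   homogeneity parameter alpha (alpha = 0 being the logarithmic potential) and
   mass parameter
     beta = 27 (m1 m2 + m1 m3 + m2 m3) / (m1 + m2 + m3)^2,
   on which alone it depends. *)
Definition Lambda3_rows beta alpha : seq (seq R) :=
  let s := (alpha + 2) / 3 * Num.sqrt (9 - beta) in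
  [:: [:: 0;   1; (alpha + s) / 2; 0              ];
      [:: - 1; 0; 0;               (alpha - s) / 2];
      [:: 1;   0; 0;               1              ];
      [:: 0;   1; - 1;             0              ]].

Definition Lambda3 beta alpha : 'M[R]_4 :=
  \matrix_(i < 4, j < 4) (nth [::] (Lambda3_rows beta alpha) i)`_j.

Definition Lambda3C beta alpha : 'M[R[i]]_4 :=
  map_mx (real_complex R) (Lambda3 beta alpha).

(* [eigenvalue] and [diagonalizable] act on row vectors; neither the spectrum
   nor diagonalisability changes under transposition. *)
Definition spectrally_stable beta alpha : Prop :=
  forall z : R[i], eigenvalue (Lambda3C beta alpha) z -> complex.Re z = 0.

Definition linearly_stable beta alpha : Prop :=
  spectrally_stable beta alpha /\ diagonalizable (Lambda3C beta alpha).

Definition parameter_rectangle : set (R * R) := `]0, 9] `*` `[0, 2[.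

Definition threshold alpha : R := 9 * ((alpha - 2) / (alpha + 2)) ^+ 2.

Definition LS : set (R * R) :=
  [set p | parameter_rectangle p /\ p.1 < threshold p.2].

Definition SS : set (R * R) :=
  [set p | parameter_rectangle p /\ p.1 = threshold p.2].

Definition SI : set (R * R) :=
  [set p | parameter_rectangle p /\ p.1 > threshold p.2].

End LagrangeEquilibrium.

Arguments parameter_rectangle R : clear implicits.
Arguments LS R : clear implicits.
Arguments SS R : clear implicits.
Arguments SI R : clear implicits.

(* Main.v *)
(* [Lambda3] is annihilated by X^4 + (2 - alpha) X^2 + c, where
   c = beta ((alpha + 2) / 6)^2 > 0, whose discriminant in X^2 is a positive
   multiple of threshold alpha - beta. If it is nonnegative, both roots in X^2
   are negative, so every eigenvalue is one of +/- i mu, +/- i nu; these four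
   are distinct exactly off the curve. If it is negative, X^2 takes no real
   value, so no eigenvalue is imaginary. *)
Require Import Defs.
From mathcomp Require Import all_boot all_order all_algebra.
From mathcomp Require Import complex.
From mathcomp Require Import classical_sets set_interval reals.
From mathcomp Require Import ring lra.

Local Open Scope ring_scope.
Local Open Scope classical_set_scope.

Import Order.TTheory GRing.Theory Num.Theory.

Section LagrangeStability.
Variable R : realType.
Implicit Types beta alpha : R.

(** When the eigenvalues are [+/- i mu] and [+/- i nu], this is the product [mu^2 nu^2] of the
    squared frequencies. *)
Definition frequency_product beta alpha : R := beta * ((alpha + 2) / 6) ^+ 2.

(** Serves twice: the fourth power is computed as the square of this matrix, and its off-diagonal
    entries show that it is never scalar. *)
Lemma Lambda3_sqr beta alpha :
  Lambda3 beta alpha *m Lambda3 beta alpha =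
  \matrix_(i < 4, j < 4) (nth [::] (
    let s := (alpha + 2) / 3 * Num.sqrt (9 - beta) in
    [:: [:: (alpha + s) / 2 - 1; 0; 0; alpha];
        [:: 0; (alpha - s) / 2 - 1; - alpha; 0];
        [:: 0; 2; (alpha + s) / 2 - 1; 0];
        [:: - 2; 0; 0; (alpha - s) / 2 - 1]]) i)`_j.
Proof.
apply/matrixP => i j; rewrite !mxE !big_ord_recl big_ord0 !mxE /=.
by case: i => [[|[|[|[|//]]]] ?]; case: j => [[|[|[|[|//]]]] ?] /=; field.
Qed.

Lemma Lambda3_annihilator beta alpha : beta <= 9 ->
  horner_mx (Lambda3 beta alpha)
    ('X^4 + (2 - alpha)%:P * 'X^2 + (frequency_product beta alpha)%:P) = 0.
Proof.
move=> le9; rewrite rmorphD /= rmorphD /= rmorphXn /= rmorphM /= rmorphXn /=.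
rewrite horner_mx_X !horner_mx_C.
rewrite (exprM _ 2 2) !expr2 -!mulmxE Lambda3_sqr.
have : Num.sqrt (9 - beta) ^+ 2 = 9 - beta by rewrite sqr_sqrtr ?subr_ge0.
set s := Num.sqrt _ => ss.
apply/matrixP => i j; rewrite !mxE !big_ord_recl !big_ord0 !mxE /=.
rewrite /frequency_product.
(* Eliminating [beta] in favour of the square root [s] turns every entry into a rational identity in
   [alpha] and [s], within reach of [field]. *)
have {le9} -> : beta = 9 - s ^+ 2 by rewrite ss; ring.
by case: i => [[|[|[|[|//]]]] ?]; case: j => [[|[|[|[|//]]]] ?] /=;
  rewrite ?mulr0n ?mulr1n; field.
Qed.

Lemma mxminpoly_Lambda3C_dvd beta alpha : beta <= 9 ->
  mxminpoly (Lambda3C beta alpha) %|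
  'X^4 + ((2 - alpha)%:C%C)%:P * 'X^2 + ((frequency_product beta alpha)%:C%C)%:P.
Proof.
move=> le9; apply/mxminpoly_min.
have := congr1 (map_mx (real_complex R)) (Lambda3_annihilator _ alpha le9).
rewrite map_horner_mx map_mx0 => <-; congr (horner_mx _ _).
by rewrite !(rmorphD (map_poly _)) /= map_polyXn (rmorphM (map_poly _)) /=
  map_polyXn !map_polyC.
Qed.

Lemma subset_uniq_dvdp (F : fieldType) (r s : seq F) :
  uniq r -> {subset r <= s} ->
  \prod_(x <- r) ('X - x%:P) %| \prod_(x <- s) ('X - x%:P).
Proof.
move=> ur rs; apply: uniq_roots_dvdp; last by rewrite uniq_rootsE.
by apply/allP => x /rs; rewrite root_prod_XsubC.
Qed.

Lemma discriminantE beta alpha : 0 <= alpha ->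
  (2 - alpha) ^+ 2 - 4 * frequency_product beta alpha =
  ((alpha + 2) / 3) ^+ 2 * (threshold alpha - beta).
Proof. by move=> ge0; rewrite /threshold /frequency_product; field; lra. Qed.

Lemma frequency_product_gt0 beta alpha : 0 < beta -> 0 <= alpha ->
  0 < frequency_product beta alpha.
Proof. by move=> b0 a0; rewrite mulr_gt0 ?exprn_gt0 //; lra. Qed.

(** [mu^2] and [nu^2] are the roots of [Y^2 - (2 - alpha) Y + c], given by the quadratic formula;
    they coincide exactly when the discriminant vanishes. *)
Lemma frequencies_exist beta alpha :
  0 < beta -> beta <= threshold alpha -> 0 <= alpha -> alpha < 2 ->
  exists mu nu : R, [/\ 0 < nu <= mu, mu ^+ 2 + nu ^+ 2 = 2 - alpha,
    mu ^+ 2 * nu ^+ 2 = frequency_product beta alpha &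
    nu = mu <-> beta = threshold alpha].
Proof.
move=> b0 bt a0 a2; have := discriminantE beta _ a0.
have c0 := frequency_product_gt0 _ _ b0 a0; set c := frequency_product _ _ in c0 *.
set k := (_ / _) ^+ 2 => discr.
have k0 : 0 < k by rewrite exprn_gt0 //; lra.
have D0 : 0 <= k * (threshold alpha - beta) by rewrite mulr_ge0 ?subr_ge0 // ltW.
set d := Num.sqrt (k * (threshold alpha - beta)).
have d0 : 0 <= d := sqrtr_ge0 _.
have dd : d ^+ 2 = (2 - alpha) ^+ 2 - 4 * c by rewrite sqr_sqrtr.
(* Since [c > 0], [d^2 < (2 - alpha)^2]; this makes the smaller root positive, hence [nu > 0]. *)
have d2 : d < 2 - alpha by nra.
exists (Num.sqrt ((2 - alpha + d) / 2)), (Num.sqrt ((2 - alpha - d) / 2)).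
rewrite !sqr_sqrtr; try lra.
split; [| lra | by move: dd; lra |].
  by rewrite sqrtr_gt0 ler_sqrt; lra.
have -> : beta = threshold alpha <-> d = 0.
  have -> : d = 0 <-> k * (threshold alpha - beta) = 0.
    split=> [d_eq0 | D_eq0]; last by rewrite /d D_eq0 sqrtr0.
    by rewrite -discr -dd d_eq0 expr0n.
  by split=> [-> | ]; rewrite ?subrr ?mulr0 //; nra.
split=> [/(congr1 (fun x => x ^+ 2)) | ->]; last by rewrite subr0 addr0.
by rewrite !sqr_sqrtr; lra.
Qed.

Definition imag (x : R) : R[i] := (0 +i* x)%C.

Lemma imag_inj : injective imag. Proof. by move=> x y []. Qed.

Lemma imagN x : - imag x = imag (- x).
Proof. by rewrite /imag; simpc. Qed.

Lemma sqr_imag x : imag x ^+ 2 = - (x ^+ 2)%:C%C.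
Proof. by rewrite expr2 /imag; simpc. Qed.

(** Applied with [x = i mu] and [y = i nu], where [-(x^2 + y^2)] becomes [mu^2 + nu^2]. *)
Lemma biquadratic_factor (F : comNzRingType) (x y : F) :
  'X^4 + (- (x ^+ 2 + y ^+ 2))%:P * 'X^2 + (x ^+ 2 * y ^+ 2)%:P =
  \prod_(z <- [:: x; - x; y; - y]) ('X - z%:P).
Proof.
by rewrite !big_cons big_nil !(polyCN, polyCD, polyCM, polyC_exp); ring.
Qed.

Lemma mxminpoly_Lambda3C_dvd_imag beta alpha (mu nu : R) : beta <= 9 ->
  mu ^+ 2 + nu ^+ 2 = 2 - alpha ->
  mu ^+ 2 * nu ^+ 2 = frequency_product beta alpha ->
  mxminpoly (Lambda3C beta alpha) %|
  \prod_(z <- map imag [:: mu; - mu; nu; - nu]) ('X - z%:P).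
Proof.
move=> le9 sum_eq prod_eq; have := mxminpoly_Lambda3C_dvd _ alpha le9.
rewrite /= -!imagN -biquadratic_factor !sqr_imag -sum_eq -prod_eq.
by rewrite mulrNN opprD !opprK -rmorphD -rmorphM.
Qed.

(** The entry in row 2, column 1 (counted from 0) of the square is 2 for all parameters. *)
Lemma Lambda3C_sqr_not_scalar beta alpha (x : R[i]) :
  Lambda3C beta alpha *m Lambda3C beta alpha <> x%:M.
Proof.
rewrite /Lambda3C -map_mxM Lambda3_sqr.
move=> /matrixP /(_ (inord 2) (inord 1)).
rewrite !mxE -val_eqE /= !inordK //= mulr0n.
by move=> [] /eqP; rewrite pnatr_eq0.
Qed.

Lemma eigenvalue_Lambda3C_imag beta alpha (mu nu : R) (z : R[i]) : beta <= 9 ->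
  mu ^+ 2 + nu ^+ 2 = 2 - alpha ->
  mu ^+ 2 * nu ^+ 2 = frequency_product beta alpha ->
  eigenvalue (Lambda3C beta alpha) z ->
  z \in map imag [:: mu; - mu; nu; - nu].
Proof.
move=> le9 sum_eq prod_eq; rewrite eigenvalue_root_min -root_prod_XsubC.
exact/root_dvdp/mxminpoly_Lambda3C_dvd_imag.
Qed.

Lemma spectrally_stable_le_threshold beta alpha :
  0 < beta -> beta <= 9 -> 0 <= alpha -> alpha < 2 ->
  beta <= threshold alpha -> spectrally_stable beta alpha.
Proof.
move=> b0 b9 a0 a2 bt z.
have [mu [nu [_ sum_eq prod_eq _]]] := frequencies_exist _ _ b0 bt a0 a2.
by move=> /(eigenvalue_Lambda3C_imag _ _ _ _ _ b9 sum_eq prod_eq) /mapP[x _ ->].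
Qed.

(** It suffices that the minimal polynomial divides a product of distinct linear factors, and
    [0 < nu < mu] separates [+/- i mu] and [+/- i nu]. *)
Lemma diagonalizable_lt_threshold beta alpha :
  0 < beta -> beta <= 9 -> 0 <= alpha -> alpha < 2 ->
  beta < threshold alpha -> diagonalizable (Lambda3C beta alpha).
Proof.
move=> b0 b9 a0 a2 bt.
have [mu [nu [/andP[nu0 le_numu] sum_eq prod_eq eqE]]] :=
  frequencies_exist _ _ b0 (ltW bt) a0 a2.
have numu : nu < mu.
  rewrite lt_neqAle le_numu andbT; apply/eqP => /eqE bE.
  by rewrite bE ltxx in bt.
apply/diagonalizableP; exists (map imag [:: mu; - mu; nu; - nu]).
  rewrite (map_inj_uniq imag_inj) /= !inE !negb_or.
  by do !(apply/andP; split) => //; apply/eqP; lra.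
exact: mxminpoly_Lambda3C_dvd_imag.
Qed.

(* On the curve the only eigenvalues are [+/- i mu], so diagonalisability would
   make the square of [Lambda3] the scalar matrix [- mu^2]. *)
Lemma not_diagonalizable_threshold beta alpha :
  0 < beta -> beta <= 9 -> 0 <= alpha -> alpha < 2 ->
  beta = threshold alpha -> ~ diagonalizable (Lambda3C beta alpha).
Proof.
move=> b0 b9 a0 a2 bt; have le_bt : beta <= threshold alpha by rewrite bt.
have [mu [nu [_ sum_eq prod_eq [_ /(_ bt) nuE]]]] :=
  frequencies_exist _ _ b0 le_bt a0 a2.
case=> P Pu Pdiag; have := diagonalizable_for_mxminpoly Pu Pdiag.
set rs := undup _ => minE.
(* The roots listed in [rs] are pairwise distinct and are eigenvalues, so each is [+/- i mu]; hence
   [X^2 + mu^2] annihilates the matrix. *)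
have /mxminpoly_minP : mxminpoly (Lambda3C beta alpha) %|
    \prod_(z <- [:: imag mu; - imag mu]) ('X - z%:P).
  rewrite minE; apply: subset_uniq_dvdp (undup_uniq _) _ => z.
  rewrite -root_prod_XsubC -minE -eigenvalue_root_min.
  move=> /(eigenvalue_Lambda3C_imag _ _ _ _ _ b9 sum_eq prod_eq).
  by rewrite nuE imagN !inE; case: (_ == _); case: (_ == _).
rewrite !big_cons big_nil mulr1 polyCN opprK -subr_sqr -polyC_exp.
rewrite rmorphB /= rmorphXn /= horner_mx_X horner_mx_C => /eqP.
rewrite subr_eq0 expr2 => /eqP; exact: Lambda3C_sqr_not_scalar.
Qed.

Lemma spectrally_unstable_gt_threshold beta alpha :
  0 < beta -> beta <= 9 -> 0 <= alpha ->
  threshold alpha < beta -> ~ spectrally_stable beta alpha.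
Proof.
move=> b0 b9 a0 tb stab.
(* Spectral stability quantifies over eigenvalues, so refuting it requires one; [R[i]] is
   algebraically closed. *)
have [z] : exists z, eigenvalue (Lambda3C beta alpha) z.
  have /closed_rootP[z] : size (char_poly (Lambda3C beta alpha)) != 1%N.
    by rewrite size_char_poly.
  by rewrite -eigenvalue_root_char; exists z.
move=> zev; have z0 := stab z zev; move: zev.
rewrite eigenvalue_root_min => /(root_dvdp (mxminpoly_Lambda3C_dvd _ alpha b9)).
have -> : z = imag (complex.Im z) by case: (z) z0 => x y /= ->.
set y := complex.Im z; rewrite /root 2!hornerD hornerXn hornerM !hornerC hornerXn (exprM _ 2 2) sqr_imag.
rewrite sqrrN mulrN -!(rmorphXn, rmorphM, rmorphB, rmorphD) /= => /eqP[y_root].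
have discr := discriminantE beta _ a0.
(* Completing the square in [y^4 - (2 - alpha) y^2 + c = 0] equates a real square with the negative
   discriminant. *)
have := sqr_ge0 (2 * y ^+ 2 - (2 - alpha)); apply/negP; rewrite -ltNge.
have -> : (2 * y ^+ 2 - (2 - alpha)) ^+ 2 =
    (2 - alpha) ^+ 2 - 4 * frequency_product beta alpha by move: y_root; lra.
by rewrite discr pmulr_rlt0 ?subr_lt0 // exprn_gt0 //; lra.
Qed.

End LagrangeStability.

Theorem proposition4p5 (R : realType) :
  [/\ LS R `|` SS R `|` SI R = parameter_rectangle R,
      LS R `&` SS R = set0,
      LS R `&` SI R = set0 &
      SS R `&` SI R = set0] /\
  [/\ forall beta alpha : R, LS R (beta, alpha) -> linearly_stable beta alpha,
      forall beta alpha : R, SS R (beta, alpha) ->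
        spectrally_stable beta alpha /\ ~ linearly_stable beta alpha &
      forall beta alpha : R, SI R (beta, alpha) ->
        ~ spectrally_stable beta alpha].
Proof.
have rectE beta alpha : parameter_rectangle R (beta, alpha) ->
    [/\ 0 < beta, beta <= 9, 0 <= alpha & alpha < 2].
  by case; rewrite /= !in_itv /= => /andP[? ?] /andP[? ?].
split; split.
- apply/seteqP; split=> [p [[] []|[]] //|p pr].
  by case: (ltgtP p.1 (threshold p.2)) => ?; [left; left|right|left; right].
- by apply/seteqP; split=> // p [[_ +] [_ e]]; rewrite e ltxx.
- by apply/seteqP; split=> // p [[_ /= /lt_trans h] [_ /h]]; rewrite ltxx.
- by apply/seteqP; split=> // p [[_ e] [_]]; rewrite /= e ltxx.
- move=> beta alpha [/rectE[? ? ? ?] /= lt_t]; split.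
    by apply: spectrally_stable_le_threshold => //; exact: ltW.
  exact: diagonalizable_lt_threshold.
- move=> beta alpha [/rectE[? ? ? ?] /= eq_t]; split.
    by apply: spectrally_stable_le_threshold; rewrite // eq_t.
  by case=> _; exact: not_diagonalizable_threshold.
- move=> beta alpha [/rectE[? ? ? ?] /= gt_t].
  exact: spectrally_unstable_gt_threshold.
Qed.
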